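(* There is no modular lattice $K$ of locally finite length such that the semilattice $\mathrm{Con_c}\,K$ of all compact congruences of $K$ is isomorphic to $S_{\omega_1}$.
   Context: A lattice $K$ has locally finite length if every finitely generated sublattice of $K$ has finite length. A compact congruence is a finitely generated congruence; $\mathrm{Con_c}\,K$ is the join-semilattice with zero of all compact congruences of $K$, under inclusion. The semilattice $S_{\omega_1}$: ordinals are identified with the set of smaller ordinals. Let $\mathcal{B}_{\omega_1}$ be the Boolean subalgebra of the powerset of $\omega_1$ generated by all intervals of $\omega_1$. Put $\mathcal{I}_{\omega_1}=\{x\in\mathcal{B}_{\omega_1}\mid \exists\alpha<\omega_1,\ x\subseteq\alpha\}$, $\mathcal{F}_{\omega_1}=\{x\in\mathcal{B}_{\omega_1}\mid \exists\alpha<\omega_1,\ \omega_1\setminus\alpha\subseteq x\}$, $D_{\omega_1}=\{x\subseteq\omega_1\mid x\text{ is finite or }x=\omega_1\}$, and $D_{\omega_1}^-=D_{\omega_1}\setminus\{\varnothing\}$. Then $S_{\omega_1}=(\{\varnothing\}\times\mathcal{I}_{\omega_1})\cup(D_{\omega_1}^-\times\mathcal{F}_{\omega_1})$, ordered by componentwise inclusion; it is a distributive join-semilattice with $0$ and $1$ (joins are componentwise unions). *)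

(* Defs.v *)
From HB Require Import structures.
From mathcomp Require Import all_boot all_order.
From mathcomp Require Import interval.
From mathcomp Require Import boolp classical_sets functions cardinality set_interval.
From mathcomp Require wochoice.

Set Implicit Arguments.
Unset Strict Implicit.
Unset Printing Implicit Defensive.

Import Order.TTheory.

Local Open Scope order_scope.
Local Open Scope classical_set_scope.

(* The notations `&` and `|` of classical_set_scope shadow the lattice ones. *)
Local Notation meet := Order.meet.
Local Notation join := Order.join.

Fact semilattice_display : Order.disp_t. Proof. exact: Order.Disp tt tt. Qed.

Section Lattices.
Context {d : Order.disp_t} (K : latticeType d).

Definition modular : Prop :=
  forall x y z : K, x <= z -> join x (meet y z) = meet (join x y) z.

Definition sublattice (A : set K) : Prop :=
  forall x y, A x -> A y -> A (meet x y) /\ A (join x y).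

(* A chain with n.+1 elements has length n. *)
Definition finite_length (A : set K) : Prop :=
  exists n : nat, forall c : seq K,
    sorted <%O c -> [set` c] `<=` A -> (size c <= n.+1)%N.

Definition locally_finite_length : Prop :=
  forall X : set K, finite_set X -> finite_length (smallest sublattice X).

Record congruence (theta : set (K * K)) : Prop := Congruence {
  congruence_refl : forall x, theta (x, x);
  congruence_sym : forall x y, theta (x, y) -> theta (y, x);
  congruence_trans : forall x y z,
    theta (x, y) -> theta (y, z) -> theta (x, z);
  congruence_meet : forall x x' y y',
    theta (x, x') -> theta (y, y') -> theta (meet x y, meet x' y');
  congruence_join : forall x x' y y',
    theta (x, x') -> theta (y, y') -> theta (join x y, join x' y') }.

Definition compact_congruence : set (set (K * K)) :=
  [set theta | exists2 X, finite_set X & theta = smallest congruence X].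

Lemma smallest_congruence (X : set (K * K)) :
  congruence (smallest congruence X).
Proof.
split.
- by move=> x A /= [cA _]; exact: congruence_refl.
- by move=> x y h A [cA XA]; apply: congruence_sym => //; exact: h.
- move=> x y z h1 h2 A [cA XA].
  by apply: congruence_trans (h1 A _) (h2 A _).
- move=> x x' y y' h1 h2 A [cA XA].
  by apply: congruence_meet => //; [exact: h1|exact: h2].
- move=> x x' y y' h1 h2 A [cA XA].
  by apply: congruence_join => //; [exact: h1|exact: h2].
Qed.

Record Conc : Type := MkConc {
  conc_val : set (K * K);
  conc_valP : conc_val \in compact_congruence }.

HB.instance Definition _ := [isSub for conc_val].
HB.instance Definition _ := [Choice of Conc by <:].
HB.instance Definition _ := 
  [SubChoice_isSubPOrder of Conc by <: with semilattice_display].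

Lemma Conc_leP (a b : Conc) : reflect (val a `<=` val b) (a <= b).
Proof. by rewrite leEsub; apply: (iffP idP); rewrite subsetEset. Qed.

Lemma Conc_congruence (a : Conc) : congruence (val a).
Proof. by case: a => t /= /set_mem[X _ ->]; exact: smallest_congruence. Qed.

Lemma Conc_join_subproof (a b : Conc) :
  smallest congruence (val a `|` val b) \in compact_congruence.
Proof.
case: a b => [t /= /set_mem[X fX ->]] [u /= /set_mem[Y fY ->]].
apply: mem_set; exists (X `|` Y); first by rewrite finite_setU.
apply/seteqP; split; apply: smallest_sub; try exact: smallest_congruence.
- rewrite subUset; split; apply: smallest_sub;
    try exact: smallest_congruence; move=> p Xp; apply: sub_gen_smallest.
    by left.
  by right.
- by move=> p [Xp|Yp]; apply: sub_gen_smallest;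
    [left|right]; exact: sub_gen_smallest.
Qed.

Definition Conc_join (a b : Conc) : Conc := MkConc (Conc_join_subproof a b).

Lemma Conc_leUx (a b c : Conc) : (Conc_join a b <= c) = (a <= c) && (b <= c).
Proof.
apply/Conc_leP/andP => /= [h|[/Conc_leP ac /Conc_leP bc]].
  by split; apply/Conc_leP; apply: subset_trans h => p hp;
    apply: sub_gen_smallest; [left|right].
by apply: smallest_sub; [exact: Conc_congruence|rewrite subUset].
Qed.

HB.instance Definition _ := Order.POrder_isJoinSemilattice.Build
  semilattice_display Conc Conc_leUx.

Lemma Conc_bottom_subproof : smallest congruence set0 \in compact_congruence.
Proof. by apply: mem_set; exists set0. Qed.

Definition Conc_bottom : Conc := MkConc Conc_bottom_subproof.

Lemma Conc_le0x (a : Conc) : Conc_bottom <= a.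
Proof.
by apply/Conc_leP; apply: smallest_sub => //; exact: Conc_congruence.
Qed.

HB.instance Definition _ := Order.hasBottom.Build
  semilattice_display Conc Conc_le0x.

End Lattices.

(* The ordinal omega_1, up to isomorphism: an uncountable well-ordered set all
   of whose proper initial segments are countable. *)
Definition is_omega1 {d : Order.disp_t} (W : bOrderType d) : Prop :=
  [/\ wochoice.well_order (<=%O : rel W),
      ~ countable [set: W] &
      forall a : W, countable [set b : W | b < a]].

Section SOmega1.
Context {d : Order.disp_t} (W : bOrderType d).

(* The ordinal a, identified with the set of all smaller ordinals. *)
Definition ordinal_set (a : W) : set W := [set b | b < a].

Definition boolean_subalgebra (G : set (set W)) : Prop :=
  [/\ G set0, G setT,
      forall x y, G x -> G y -> G (x `&` y),
      forall x y, G x -> G y -> G (x `|` y) &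
      forall x, G x -> G (~` x)].

Definition interval_algebra : set (set W) :=
  smallest boolean_subalgebra [set [set` i] | i in [set: interval W]].

Definition bounded_intervals : set (set W) :=
  [set x | interval_algebra x /\ exists a, x `<=` ordinal_set a].

Definition cobounded_intervals : set (set W) :=
  [set x | interval_algebra x /\ exists a, ~` ordinal_set a `<=` x].

Definition finite_or_full : set (set W) :=
  [set x | finite_set x \/ x = setT].

(* *p carries the componentwise order; its joins are componentwise unions. *)
Definition Somega1_set : set (set W *p set W) :=
  [set set0] `*` bounded_intervals `|`
  (finite_or_full `\ set0) `*` cobounded_intervals.

Record Somega1 : Type := MkSomega1 {
  somega1_val : set W *p set W;
  somega1_valP : somega1_val \in Somega1_set }.

HB.instance Definition _ := [isSub for somega1_val].
HB.instance Definition _ := [Choice of Somega1 by <:].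
HB.instance Definition _ :=
  [SubChoice_isSubPOrder of Somega1 by <: with semilattice_display].

Lemma interval_algebra_boolean : boolean_subalgebra interval_algebra.
Proof.
split.
- by move=> A [[]].
- by move=> A [[]].
- move=> x y hx hy A hA; have [[_ _ h _ _] _] := hA.
  by apply: h; [exact: hx|exact: hy].
- move=> x y hx hy A hA; have [[_ _ _ h _] _] := hA.
  by apply: h; [exact: hx|exact: hy].
- by move=> x hx A hA; have [[_ _ _ _ h] _] := hA; apply: h; exact: hx.
Qed.

Lemma Somega1_leP (p q : Somega1) :
  reflect ((val p).1 `<=` (val q).1 /\ (val p).2 `<=` (val q).2) (p <= q).
Proof.
rewrite leEsub leEprod.
by apply: (iffP andP) => -[]; rewrite !subsetEset.
Qed.

Lemma Somega1_join_subproof (p q : Somega1) :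
  ((val p).1 `|` (val q).1, (val p).2 `|` (val q).2) \in Somega1_set.
Proof.
have [_ _ _ BU _] := interval_algebra_boolean.
have FU x y : cobounded_intervals x -> interval_algebra y ->
    cobounded_intervals (x `|` y).
  move=> [Bx [a ax]] By; split; first exact: BU.
  by exists a; apply: subset_trans ax _; left.
have DU x y : (finite_or_full `\ set0) x -> finite_or_full y ->
    (finite_or_full `\ set0) (x `|` y).
  move=> [Dx x0] Dy; split; last by rewrite /= setU_eq0 => -[].
  case: Dx => [fx|->]; last by rewrite setTU; right.
  by case: Dy => [fy|->]; [left; rewrite finite_setU|rewrite setUT; right].
case: p q => [[p1 p2] /= /set_mem hp] [[q1 q2] /= /set_mem hq].
apply: mem_set; case: hp hq => [[/= -> Ip]|[/= Dp Fp]] [[/= -> Iq]|[/= Dq Fq]].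
- left; split=> /=; first by rewrite setU0.
  case: Ip Iq => [Bp [a pa]] [Bq [b qb]]; split; first exact: BU.
  exists (Order.max a b) => x [/pa|/qb]; rewrite /ordinal_set /= lt_max => -> //.
  by rewrite orbT.
- right; split=> /=; first by rewrite set0U.
  by rewrite setUC; apply: FU => //; case: Ip.
- right; split=> /=; first by rewrite setU0.
  by apply: FU => //; case: Iq.
- right; split=> /=; first by apply: DU => //; case: Dq.
  by apply: FU => //; case: Fq.
Qed.

Definition Somega1_join (p q : Somega1) : Somega1 :=
  MkSomega1 (Somega1_join_subproof p q).

Lemma Somega1_leUx (p q r : Somega1) :
  (Somega1_join p q <= r) = (p <= r) && (q <= r).
Proof.
apply/Somega1_leP/andP => /= [[]|[/Somega1_leP[? ?] /Somega1_leP[? ?]]].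
  by rewrite !subUset => -[? ?] [? ?]; split; apply/Somega1_leP.
by rewrite !subUset.
Qed.

HB.instance Definition _ := Order.POrder_isJoinSemilattice.Build
  semilattice_display Somega1 Somega1_leUx.

Lemma Somega1_bottom_subproof : (set0, set0) \in Somega1_set.
Proof.
have [B0 _ _ _ _] := interval_algebra_boolean.
by apply: mem_set; left; split=> //; split=> //; exists \bot.
Qed.

Definition Somega1_bottom : Somega1 := MkSomega1 Somega1_bottom_subproof.

Lemma Somega1_le0x (p : Somega1) : Somega1_bottom <= p.
Proof. by apply/Somega1_leP; split; exact: sub0set. Qed.

HB.instance Definition _ := Order.hasBottom.Build
  semilattice_display Somega1 Somega1_le0x.

End SOmega1.

Definition semilattice_isomorphic {d d' : Order.disp_t}
    (S : bJoinSemilatticeType d) (T : bJoinSemilatticeType d') : Prop :=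
  exists f : S -> T,
    [/\ bijective f, f \bot = \bot & forall x y, f (join x y) = join (f x) (f y)].

(* omega_1 as a suitable initial segment of a well-ordering of set nat. *)
Section WellOrderSegment.
Variables (T : choiceType) (R : rel T) (A : set T) (a0 : T).
Hypotheses (wR : wochoice.well_order R) (Aa0 : a0 \in A).

Let R_chain : wochoice.wo_chain R T.
Proof. by move=> P _; exact: wR. Qed.

Let R_total : total R.
Proof. by move=> x y; apply: (wochoice.wo_chainW R_chain). Qed.

Let R_anti : antisymmetric R.
Proof. by move=> x y; apply: (wochoice.wo_chain_antisymmetric R_chain). Qed.

Let R_refl : reflexive R.
Proof. by move=> x; have := R_total x x; rewrite orbb. Qed.

Let R_trans : transitive R.
Proof.
move=> y x z xy yz.
have [|m [[mA mlb] _]] := @wR [pred t | t \in [:: x; y; z]].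
  by exists x; rewrite !inE eqxx.
have mx : R m x by apply: mlb; rewrite !inE eqxx.
have my : R m y by apply: mlb; rewrite !inE eqxx orbT.
have mz : R m z by apply: mlb; rewrite !inE eqxx !orbT.
move: mA; rewrite !inE => /or3P[]/eqP em; subst m => //.
  by rewrite (@R_anti x y) // xy mx.
by rewrite -(@R_anti y z) // yz my.
Qed.

Record wo_segment := WoSegment { seg_val : T; _ : seg_val \in A }.

HB.instance Definition _ := [isSub for seg_val].
HB.instance Definition _ := [Choice of wo_segment by <:].

Let le (x y : wo_segment) := R (val x) (val y).

Let le_refl : reflexive le. Proof. by move=> x; exact: R_refl. Qed.
Let le_anti : antisymmetric le.
Proof. by move=> x y /R_anti/val_inj. Qed.
Let le_trans : transitive le. Proof. by move=> y x z; exact: R_trans. Qed.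

Lemma wo_segment_omega1 :
  ~ countable A ->
  (forall a, a \in A -> countable [set b | R b a /\ b <> a]) ->
  exists (d : Order.disp_t) (W : bOrderType d), is_omega1 W.
Proof.
move=> Au Ac.
have le_wo : wochoice.well_order le.
  apply: wochoice.antisymmetric_well_order => [|P [x Px]]; first exact: le_anti.
  have [|m [[mA mlb] _]] :=
    @wR [pred t | `[< exists2 y : wo_segment, y \in P & val y = t >]].
    by exists (val x); apply/asboolP; exists x.
  move: mA => /asboolP[y Py ym]; exists y; split=> // z Pz.
  by rewrite /le ym; apply: mlb; apply/asboolP; exists z.
have [|bot [[_ botP] _]] := le_wo predT; first by exists (WoSegment Aa0).
pose pM := Order.Le_isPOrder.Build semilattice_display
  wo_segment le_refl le_anti le_trans.
pose pT : porderType semilattice_display := HB.pack wo_segment pM.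
pose bM := Order.hasBottom.Build semilattice_display pT
  (fun x => botP x isT : bot <= x :> pT).
pose tM := Order.POrder_isTotal.Build semilattice_display
  pT (fun x y => R_total (val x) (val y)).
pose W : bOrderType semilattice_display := HB.pack wo_segment pM tM bM.
have leW (x y : W) : (x <= y) = le x y by [].
exists semilattice_display, W; split; first exact: le_wo.
- move=> /countable_injP[f fI]; apply: Au; apply/countable_injP.
  exists (fun t => if pselect (t \in A) is left tA then f (WoSegment tA) else 0%N).
  move=> x y xA yA; case: pselect => // {}xA; case: pselect => // {}yA /fI.
  by rewrite !in_setT => /(_ isT isT) [].
- move=> a; have /countable_injP[f fI] := Ac _ (valP (a : wo_segment)).
  apply/countable_injP; exists (fun x : W => f (val (x : wo_segment))) => x y.
  rewrite !inE /= => xa ya /fI fxy.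
  apply: (@val_inj _ _ wo_segment); apply: fxy; rewrite inE; split.
  + exact: (ltW xa).
  + by move=> /val_inj exa; rewrite exa ltxx in xa.
  + exact: (ltW ya).
  + by move=> /val_inj eya; rewrite eya ltxx in ya.
Qed.

End WellOrderSegment.

Lemma uncountable_set_nat : ~ countable [set: set nat].
Proof.
move=> /countable_injP[f fI].
pose D := [set n | exists2 X, f X = n & ~ X n].
have DP : ~ D (f D).
  move=> [X /fI]; rewrite !in_setT => /(_ isT isT) -> nD.
  by apply: (nD); exists D.
by apply: (DP); exists D.
Qed.

Lemma omega1_exists :
  exists (d : Order.disp_t) (W : bOrderType d), is_omega1 W.
Proof.
have [R wR] := wochoice.well_ordering_principle (set nat).
pose seg a := [set b | R b a /\ b <> a].
have [[a0 ua0]|sc] := pselect (exists a, ~ countable (seg a)); last first.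
  have A0 : set0 \in [set: set nat] by rewrite in_setT.
  apply: (wo_segment_omega1 wR A0); first exact: uncountable_set_nat.
  by move=> a _; apply: contrapT => ua; apply: sc; exists a.
have [|a [[ua amin] _]] := wR [pred a | `[< ~ countable (seg a) >]].
  by exists a0; apply/asboolP.
move: ua => /asboolP ua.
have [sa0|/set0P[b /mem_set sb]] := eqVneq (seg a) set0.
  by case: ua; rewrite sa0.
apply: (wo_segment_omega1 wR sb) => // c.
rewrite inE => -[Rca ca]; apply: contrapT => uc; apply: ca.
have chR : wochoice.wo_chain R predT.
  by move=> P _; exact: wR.
apply: (wochoice.wo_chain_antisymmetric chR) => //.
by rewrite Rca amin //; apply/asboolP.
Qed.

(* Main.v *)
(* Write S for S_omega1 and suppose Con_c K = S. On a sublattice L of finite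
   length, the Jordan-Hoelder theorem turns every weight of prime intervals that
   is invariant under transposition into a valuation, i.e. an additive function
   of intervals; counting the composition factors projective to a given prime
   interval is the main example.

   For each xi < omega1 there is an interval e_xi of K whose congruence has first
   component {xi}, and e_xi can be taken inside one of the finitely many intervals
   [a, b] that generate the top congruence. The second component of con(e_xi)
   contains [alpha_xi, omega1). For every beta there is n such that, over
   [alpha_xi, beta), the dimension of [a, b] is at most n times that of e_xi;
   since a nondecreasing map from omega1 to omega is eventually constant, a single
   n_xi serves all beta. By the pigeonhole principle infinitely many xi share
   [a, b] and n. Pick n + 1 of them. A factor common to two of the e_xi has empty
   first component, hence bounded second component; so over [alpha, beta), for
   alpha large, the e_xi are disjoint parts of [a, b] and their dimensions add up
   to at most v(a, b), where v counts the factors projective to a prime interval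
   over [alpha, beta). Then (n + 1) v(a, b) <= n v(a, b), although v(a, b) > 0. *)
Require Import Defs.
From mathcomp Require Import all_boot all_order.
From mathcomp Require Import interval.
From mathcomp Require Import boolp classical_sets functions cardinality.
From mathcomp Require Import zify.

Set Implicit Arguments.
Unset Strict Implicit.
Unset Printing Implicit Defensive.

Import Order.TTheory.

(** * Valuations on intervals and the Jordan-Hoelder theorem *)

Section Valuations.
Local Open Scope order_scope.
Local Open Scope classical_set_scope.
Local Notation meet := Order.meet.
Local Notation join := Order.join.
Context {d : Order.disp_t} (K : latticeType d).
Implicit Types (L : set K) (x y z t : K) (s r : seq K) (T : Type).

Definition transposition_invariant T L (w : K -> K -> T) :=
  forall x y, L x -> L y -> w (meet x y) x = w y (join x y).

Definition valuation L (v : K -> K -> nat) :=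
  (forall x y z, L x -> L y -> L z -> x <= y -> y <= z ->
     v x z = (v x y + v y z)%N) /\ transposition_invariant L v.

Definition covers L x y :=
  [/\ L x, L y, x < y & forall z, L z -> x <= z -> z <= y -> z = x \/ z = y].

(** A chain is stored as its first element [x] and the list [s] of the later ones; [zip] cuts off
    the surplus last element of [x :: s]. *)
Definition steps x s : seq (K * K) := zip (x :: s) s.

Definition maximal_chain L x s :=
  forall p, p \in steps x s -> covers L p.1 p.2.

Definition weight (w : K -> K -> nat) x s :=
  (\sum_(p <- steps x s) w p.1 p.2)%N.

Lemma steps_cons x y s : steps x (y :: s) = (x, y) :: steps y s.
Proof. by []. Qed.

Lemma steps_cat x s r : steps x (s ++ r) = steps x s ++ steps (last x s) r.
Proof. by elim: s x => //= y s IH x; rewrite !steps_cons IH. Qed.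

Lemma steps_map (f : K -> K) x s :
  steps (f x) (map f s) = [seq (f p.1, f p.2) | p <- steps x s].
Proof. by elim: s x => //= y s IH x; rewrite !steps_cons IH. Qed.

Lemma maximal_chain_cons L x y s :
  maximal_chain L x (y :: s) <-> covers L x y /\ maximal_chain L y s.
Proof.
split=> [h|[c h] p]; last by rewrite steps_cons inE => /orP[/eqP->|/h].
split; first by apply: (h (x, y)); rewrite steps_cons mem_head.
by move=> p ps; apply: h; rewrite steps_cons inE ps orbT.
Qed.

Lemma maximal_chain_cat L x s r :
  maximal_chain L x s -> maximal_chain L (last x s) r ->
  maximal_chain L x (s ++ r).
Proof. by move=> hs hr p; rewrite steps_cat mem_cat => /orP[/hs|/hr]. Qed.

Lemma weight_cat w x s r :
  weight w x (s ++ r) = (weight w x s + weight w (last x s) r)%N.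
Proof. by rewrite /weight steps_cat big_cat. Qed.

Lemma weight_cons w x y s : weight w x (y :: s) = (w x y + weight w y s)%N.
Proof. by rewrite /weight steps_cons big_cons. Qed.

Lemma maximal_chain_last L x s : L x -> maximal_chain L x s -> L (last x s).
Proof.
elim: s x => //= y s IH x _ /maximal_chain_cons[[_ Ly _ _] h]; exact: IH.
Qed.

Lemma maximal_chain_le L x s : maximal_chain L x s -> x <= last x s.
Proof.
elim: s x => //= y s IH x /maximal_chain_cons[[_ _ xy _] h].
by rewrite (le_trans (ltW xy)) // IH.
Qed.

Lemma maximal_chain_steps L x s p : maximal_chain L x s -> p \in steps x s ->
  x <= p.1 /\ p.2 <= last x s.
Proof.
elim: s x => //= y s IH x /maximal_chain_cons[[_ _ xy _] h].
rewrite steps_cons inE => /orP[/eqP->|/IH] /=.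
  by split=> //; exact: maximal_chain_le h.
by move=> /(_ h)[yp ->]; split=> //; rewrite (le_trans (ltW xy)).
Qed.

(** Induction on a bound for the sizes of chains inside [[x, y]]: a point strictly between lowers it
    on both halves, whose chains extend by [y] or by [x]. *)
Lemma exists_maximal_chain L x y : finite_length L -> L x -> L y -> x <= y ->
  exists2 s, maximal_chain L x s & last x s = y.
Proof.
move=> [n hn] Lx Ly xy.
pose short k := forall c : seq K, sorted <%O c -> [set` c] `<=` L ->
  (forall z, z \in c -> x <= z /\ z <= y) -> (size c <= k)%N.
have : short n.+1 by move=> c sc cL _; exact: hn.
rewrite {}/short; elim: (n.+1) x y Lx Ly xy {hn} => [|k IH] x y Lx Ly xy short.
  have /= := short [:: x] isT; rewrite ltnn => h; suff: false by [].
  by apply: h => [z /=|z]; rewrite inE => /eqP->.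
have [xy0|xNy] := eqVneq x y.
  by exists [::].
have xlty : x < y by rewrite lt_neqAle xNy.
have [[z [Lz xz zy]]|nz] := pselect (exists z, [/\ L z, x < z & z < y]).
- have [|s hs ls] := IH x z Lx Lz (ltW xz).
    move=> c sc cL cxz.
    have := short (rcons c y); rewrite size_rcons ltnS; apply.
    + rewrite -cats1; case: c sc cL cxz => //= t c sc cL cxz.
      rewrite cat_path sc /= andbT.
      by have [|_ h] := cxz (last t c); [exact: mem_last|exact: le_lt_trans zy].
    + by move=> t /=; rewrite mem_rcons inE => /orP[/eqP->|/cL].
    + move=> t; rewrite mem_rcons inE => /orP[/eqP->|/cxz[? tz]] //.
      by split=> //; rewrite (le_trans tz) // ltW.
  have [|r hr lr] := IH z y Lz Ly (ltW zy).
    move=> c sc cL czy.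
    have := short (x :: c); rewrite /= ltnS; apply.
    + case: c sc cL czy => //= t c -> cL czy; rewrite andbT.
      by have [|h _] := czy t; [exact: mem_head|exact: lt_le_trans xz h].
    + by move=> t /=; rewrite inE => /orP[/eqP->|/cL].
    + move=> t; rewrite inE => /orP[/eqP->|/czy[zt ?]] //.
      by split=> //; rewrite (le_trans _ zt) // ltW.
  exists (s ++ r); last by rewrite last_cat ls.
  by apply: maximal_chain_cat => //; rewrite ls.
- exists [:: y] => //; apply/maximal_chain_cons; split=> //.
  split=> // z Lz xz zy.
  have [->|zx] := eqVneq z x; first by left.
  have [->|zy'] := eqVneq z y; first by right.
  by case: nz; exists z; split=> //; rewrite lt_neqAle ?xz ?zy ?zy' // eq_sym zx.
Qed.

Section Modular.
Hypothesis modK : modular K.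
Variable L : set K.
Hypothesis subL : sublattice L.
Let Lmeet x y (Lx : L x) (Ly : L y) : L (meet x y) := (subL Lx Ly).1.
Let Ljoin x y (Lx : L x) (Ly : L y) : L (join x y) := (subL Lx Ly).2.

(** By the modular law [join y] undoes [meet x] between [y] and [join x y], so a point strictly
    inside would give one strictly between [meet x y] and [x]. *)
Lemma covers_transpose x y : L y ->
  covers L (meet x y) x -> covers L y (join x y).
Proof.
move=> Ly [_ Lx xyx h]; split=> //; first exact: Ljoin.
  rewrite lt_neqAle leUr andbT; apply: contraTneq xyx => {1}->.
  by rewrite joinKI ltxx.
move=> z Lz yz zxy.
have e : join y (meet x z) = z by rewrite modK // joinC; apply/meet_idPr.
case: (h (meet x z)); rewrite ?leIl //; first exact: Lmeet.
- by rewrite lexI leIl (le_trans (leIr _ _)).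
- by move=> exz; left; rewrite -e exz meetKUC.
- by move=> exz; right; rewrite -e exz joinC.
Qed.

Variable w : K -> K -> nat.
Hypothesis w_inv : transposition_invariant L w.

Hypothesis finL : finite_length L.

(** If the first steps lead to distinct [y] and [z], both chains are compared with chains through
    [join y z]; opposite sides of this diamond are transposes of each other. *)
Lemma jordan_holder x s r : maximal_chain L x s -> maximal_chain L x r ->
  last x s = last x r -> size s = size r /\ weight w x s = weight w x r.
Proof.
have [n] := ubnP (size s); elim: n s r x => // n IH [|y s] [|z r] x //= sn.
- move=> _ /maximal_chain_cons[[_ _ xz _] /maximal_chain_le zr] e.
  by have := lt_le_trans xz zr; rewrite -e ltxx.
- move=> /maximal_chain_cons[[_ _ xz _] /maximal_chain_le zr] _ e.
  by have := lt_le_trans xz zr; rewrite e ltxx.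
move=> /maximal_chain_cons[xy ys] /maximal_chain_cons[xz zr] e.
rewrite !weight_cons.
have [yz|yz] := eqVneq y z.
  by subst z; have [|-> ->] := IH s r y _ ys zr e.
have [Lx Ly ltxy xyP] := xy; have [_ Lz ltxz xzP] := xz.
have myz : meet y z = x.
  case: (xyP (meet y z)); rewrite ?leIl ?lexI ?ltW //; first exact: Lmeet.
  move=> /meet_idPl yz'; case: (xzP y) => // [|ey|ey]; first exact: ltW.
  by rewrite -ey ltxx in ltxy.
  by rewrite -ey eqxx in yz.
have Lyz := Ljoin Ly Lz.
have cy : covers L y (join y z).
  by rewrite joinC; apply: covers_transpose => //; rewrite meetC myz.
have cz : covers L z (join y z) by apply: covers_transpose => //; rewrite myz.
have [c hc lc] : exists2 c, maximal_chain L (join y z) c &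
    last (join y z) c = last y s.
  apply: exists_maximal_chain => //; first exact: maximal_chain_last ys.
  by rewrite leUx (maximal_chain_le ys) e (maximal_chain_le zr).
have yc : maximal_chain L y (join y z :: c) by apply/maximal_chain_cons.
have zc : maximal_chain L z (join y z :: c) by apply/maximal_chain_cons.
have [sz1 w1] := IH s _ y sn ys yc (esym lc).
have sc : (size (join y z :: c) < n)%N by rewrite -sz1.
have [sz2 w2] := IH _ r z sc zc zr (etrans lc e).
split; first by rewrite sz1 -sz2.
rewrite w1 -w2 !weight_cons !addnA; congr addn.
have := w_inv Ly Lz; have := w_inv Lz Ly.
by rewrite (meetC z) (joinC z) myz => -> ->; rewrite addnC.
Qed.

(** Independent of the chain by [jordan_holder]; the default 0 occurs only where no maximal chain
    from [x] to [y] exists. *)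
Definition total_weight x y : nat :=
  xget 0%N [set n | exists s,
    [/\ maximal_chain L x s, last x s = y & weight w x s = n]].

Lemma total_weightE x s : maximal_chain L x s ->
  total_weight x (last x s) = weight w x s.
Proof.
move=> hs; rewrite /total_weight; case: xgetP => [n _ [r [hr lr <-]]|/(_ (weight w x s))[]].
  by have [_ ->] := jordan_holder hr hs lr.
by exists s.
Qed.

Lemma valuation_total_weight : valuation L total_weight.
Proof.
split=> [x y z Lx Ly Lz xy yz|x y Lx Ly].
  have [s hs ls] := exists_maximal_chain finL Lx Ly xy.
  have [r hr lr] := exists_maximal_chain finL Ly Lz yz.
  subst y z; rewrite !total_weightE // -last_cat total_weightE ?weight_cat //.
  exact: maximal_chain_cat.
have [s hs ls] := exists_maximal_chain finL (Lmeet Lx Ly) Lx (leIl x y).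
have ey : y = join y (meet x y) by rewrite meetKUC.
have <- : last y (map (join y) s) = join x y.
  by rewrite {1}ey last_map ls joinC.
have := total_weightE hs; rewrite ls => ->.
(* By the modular law each step of [s] is the lower transpose of its image under [join y]. *)
have hp p : p \in steps (meet x y) s ->
    [/\ L p.1, L p.2, meet p.2 (join y p.1) = p.1 & join p.2 (join y p.1) = join y p.2].
  move=> ps; have [Lp1 Lp2 p12 _] := hs _ ps; have [h1 h2] := maximal_chain_steps hs ps.
  split=> //; last by rewrite joinCA; congr join; apply/join_idPl/ltW.
  rewrite meetC joinC -modK ?(ltW p12) //; apply/join_idPl.
  by rewrite (le_trans _ h1) // lexI leIl andbT (le_trans (leIr _ _)) // -ls.
rewrite total_weightE.
  rewrite {2}ey /weight steps_map big_map; apply: eq_big_seq => p ps /=.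
  have [Lp1 Lp2 e1 e2] := hp _ ps.
  by rewrite -e2 -{1}e1; apply: w_inv => //; exact: Ljoin.
move=> p; rewrite {1}ey steps_map => /mapP[q qs ->] /=.
have [Lp1 Lp2 e1 e2] := hp _ qs.
by rewrite -e2; apply: covers_transpose; [exact: Ljoin|rewrite e1; exact: hs].
Qed.

End Modular.
End Valuations.

(** * Principal congruences and generators of compact congruences *)

Section CongruencesAndValuations.
Local Open Scope order_scope.
Local Open Scope classical_set_scope.
Local Notation meet := Order.meet.
Local Notation join := Order.join.
Context {d : Order.disp_t} (K : latticeType d).
Implicit Types (L : set K) (x y z t : K) (F : seq K) (X : seq (K * K)).
Implicit Types (v : K -> K -> nat) (u : Conc K).

Ltac lattice_le := solve
  [ exact: lexx
  | rewrite lexI; apply/andP; split; lattice_le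
  | rewrite leUx; apply/andP; split; lattice_le
  | apply: leIxl; lattice_le | apply: leIxr; lattice_le
  | apply: lexUl; lattice_le | apply: lexUr; lattice_le ].

Lemma smallest_sublattice (A : set K) : sublattice (smallest (@sublattice _ K) A).
Proof.
move=> x y hx hy; split=> B [sB AB].
  by have [] := sB x y (hx _ (conj sB AB)) (hy _ (conj sB AB)).
by have [] := sB x y (hx _ (conj sB AB)) (hy _ (conj sB AB)).
Qed.

Lemma principal_subproof x y :
  smallest (@congruence _ K) [set (x, y)] \in compact_congruence (K := K).
Proof. by apply: mem_set; exists [set (x, y)]. Qed.

Definition principal x y : Conc K := MkConc (principal_subproof x y).

Lemma principal_leP x y u : reflect (val u (x, y)) (principal x y <= u).
Proof.
apply: (iffP (Conc_leP _ _)) => [|h] /=.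
  by apply; apply: sub_gen_smallest.
by apply: smallest_sub; [exact: Conc_congruence|move=> _ ->].
Qed.

Lemma principal_mem x y : val (principal x y) (x, y).
Proof. exact/principal_leP. Qed.

Lemma principal_refl x : principal x x = \bot.
Proof.
apply/eqP; rewrite -lex0; apply/principal_leP.
exact: congruence_refl (Conc_congruence \bot) x.
Qed.

Lemma principal_eq0 x y : principal x y = \bot -> x = y.
Proof.
move=> xy0; have : val (\bot : Conc K) (x, y) by rewrite -xy0; exact: principal_mem.
have : smallest (@congruence _ K) set0 `<=` [set p | p.1 = p.2]; last by apply.
apply: smallest_sub => //; split=> //= [a b c ab bc|a a' b b' -> ->|a a' b b' -> ->] //.
exact: etrans ab bc.
Qed.

Lemma principal_trans x y z :
  principal x z <= join (principal x y) (principal y z).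
Proof.
apply/principal_leP; apply: (congruence_trans (Conc_congruence _)).
  by apply/principal_leP; exact: leUl.
by apply/principal_leP; exact: leUr.
Qed.

Lemma principal_sub x y z t : x <= y -> y <= z -> z <= t ->
  principal y z <= principal x t.
Proof.
move=> xy yz zt; apply/principal_leP.
have c := Conc_congruence (principal x t).
(* The polynomial [meet z (join y _)] sends [x] to [y] and [t] to [z]. *)
have := congruence_meet c (congruence_refl c z)
  (congruence_join c (congruence_refl c y) (@principal_mem x t)).
rewrite (join_idPl xy) (join_idPr (le_trans yz zt)) (meet_idPl zt).
rewrite (meet_idPr yz); exact.
Qed.

(** Meeting with [x] carries the pair [(y, join x y)] to [(meet x y, x)], and joining with [y]
    carries it back. *)
Lemma principal_transpose L : transposition_invariant L principal.
Proof.
move=> x y _ _; apply: le_anti; apply/andP; split; apply/principal_leP.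
  have c := Conc_congruence (principal y (join x y)).
  have := congruence_meet c (congruence_refl c x) (@principal_mem y (join x y)).
  by rewrite joinKI.
have c := Conc_congruence (principal (meet x y) x).
have := congruence_join c (congruence_refl c y) (@principal_mem (meet x y) x).
by rewrite meetKUC (joinC y).
Qed.

(** Generators are oriented upwards so that each is an interval on which a valuation can be
    evaluated. *)
Definition generates X u :=
  val u = smallest (@congruence _ K) [set` X] /\ forall p, p \in X -> p.1 <= p.2.

(** A pair [(x, y)] and the comparable pair [(meet x y, join x y)] generate the same congruence. *)
Lemma exists_generators u : exists X, generates X u.
Proof.
have /set_mem[A /finite_seqP[X ->] uX] := conc_valP u.
exists [seq (meet p.1 p.2, join p.1 p.2) | p <- X]; split; last first.
  by move=> _ /mapP[p _ ->] /=; exact: le_trans (leIl _ _) (leUl _ _).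
rewrite /= uX; apply/seteqP; split; apply: smallest_sub;
  try exact: smallest_congruence.
  move=> [x y] /= pX; set T := smallest _ _.
  have c : congruence T by exact: smallest_congruence.
  have h : T (meet x y, join x y).
    by apply: sub_gen_smallest; apply/mapP; exists (x, y).
  have hx := congruence_join c h (congruence_refl c x).
  have hy := congruence_join c h (congruence_refl c y).
  rewrite meetUKC joinC joinKU in hx.
  rewrite meetUK joinC joinKUC (joinC y) in hy.
  exact (congruence_trans c hx (congruence_sym c hy)).
move=> _ /= /mapP[[x y] pX ->] /=; set T := smallest _ _.
have c : congruence T by exact: smallest_congruence.
have h : T (x, y) by exact: sub_gen_smallest.
have hm := congruence_meet c h (congruence_refl c y).
have hj := congruence_join c h (congruence_refl c y).
rewrite meetxx in hm; rewrite joinxx in hj.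
exact (congruence_trans c hm (congruence_sym c hj)).
Qed.

Lemma generates_le X u p : generates X u -> p \in X -> principal p.1 p.2 <= u.
Proof.
move=> [uX _] pX; apply/principal_leP; rewrite uX.
by apply: sub_gen_smallest; rewrite -surjective_pairing.
Qed.

Lemma generates_principal x y : x <= y -> generates [:: (x, y)] (principal x y).
Proof.
move=> xy; split; last by move=> p; rewrite inE => /eqP->.
by congr (smallest _ _); apply/seteqP; split=> p /=; rewrite inE => /eqP.
Qed.

(** [u] lies below the finite join of the principal congruences of its generators, hence in every
    ideal [Q] that contains them. *)
Lemma generates_ind (Q : Conc K -> Prop) X u : generates X u ->
  Q \bot -> (forall a b, Q a -> Q b -> Q (join a b)) ->
  (forall a b, a <= b -> Q b -> Q a) ->
  (forall p, p \in X -> Q (principal p.1 p.2)) -> Q u.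
Proof.
move=> [uX _] Q0 QU Qle QX.
apply: (Qle _ (\join_(p <- X) principal p.1 p.2)); last first.
  by rewrite big_seq; apply: big_ind.
apply/Conc_leP; rewrite uX; apply: smallest_sub.
  exact: Conc_congruence.
move=> [x y] /= pX; apply/principal_leP.
by rewrite (big_rem (x, y)) //= leUl.
Qed.

Lemma chain_ind (Q : Conc K -> Prop) L x s : maximal_chain L x s ->
  Q \bot -> (forall a b, Q a -> Q b -> Q (join a b)) ->
  (forall a b, a <= b -> Q b -> Q a) ->
  (forall p, p \in steps x s -> Q (principal p.1 p.2)) ->
  Q (principal x (last x s)).
Proof.
move=> hs Q0 QU Qle; elim: s x hs => [|y s IH] x /=; first by rewrite principal_refl.
move=> /maximal_chain_cons[_ hs] h; apply: Qle (principal_trans x y _) _.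
apply: QU; first by apply: (h (x, y)); rewrite steps_cons mem_head.
by apply: IH => // p ps; apply: h; rewrite steps_cons inE ps orbT.
Qed.

Lemma valuation_sub L L' v : L `<=` L' -> valuation L' v -> valuation L v.
Proof.
move=> s [h1 h2]; split=> [x y z Lx Ly Lz|x y Lx Ly]; last by apply: h2; exact: s.
by apply: h1; exact: s.
Qed.

(** * The kernel congruence of a valuation *)

Section Kernel.
Variables (L : set K) (v : K -> K -> nat).
Hypotheses (subL : sublattice L) (valL : valuation L v).
Let Lmeet x y (Lx : L x) (Ly : L y) : L (meet x y) := (subL Lx Ly).1.
Let Ljoin x y (Lx : L x) (Ly : L y) : L (join x y) := (subL Lx Ly).2.

Lemma valuation_refl x : L x -> v x x = 0%N.
Proof. by move=> Lx; have := valL.1 x x x Lx Lx Lx (lexx _) (lexx _); lia. Qed.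

Lemma valuation_mono x y z t : L x -> L y -> L z -> L t ->
  x <= y -> y <= z -> z <= t -> (v y z <= v x t)%N.
Proof.
move=> Lx Ly Lz Lt xy yz zt.
rewrite (valL.1 x y t) ?(valL.1 y z t) ?(le_trans yz zt) //; lia.
Qed.

Lemma valuation_chain x s : L x -> maximal_chain L x s ->
  v x (last x s) = weight v x s.
Proof.
elim: s x => [|y s IH] x Lx /=; first by rewrite valuation_refl // /weight big_nil.
move=> hs; have /maximal_chain_cons[[_ Ly xy _] ys] := hs.
rewrite weight_cons -IH // (valL.1 x y) //; first exact: maximal_chain_last ys.
  exact: ltW.
exact: maximal_chain_le ys.
Qed.

Let v0 x y z t : L x -> L y -> L z -> L t ->
  x <= y -> y <= z -> z <= t -> v x t = 0%N -> v y z = 0%N.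
Proof.
move=> Lx Ly Lz Lt xy yz zt h.
by have := valuation_mono Lx Ly Lz Lt xy yz zt; rewrite h leqn0 => /eqP.
Qed.

Let v0_trans x y z : L x -> L y -> L z -> x <= y -> y <= z ->
  v x y = 0%N -> v y z = 0%N -> v x z = 0%N.
Proof. by move=> Lx Ly Lz xy yz h1 h2; rewrite (valL.1 x y z) // h1 h2. Qed.

(** The interval from [join x z] to [join y z] transposes down to the one from [meet y (join x z)]
    to [y], which is a part of [[x, y]]. *)
Let v0_join x y z : L x -> L y -> L z -> x <= y -> v x y = 0%N ->
  v (join x z) (join y z) = 0%N.
Proof.
move=> Lx Ly Lz xy h.
have Lxz := Ljoin Lx Lz.
have -> : join y z = join y (join x z) by rewrite joinA (join_idPl xy).
rewrite -valL.2 //; apply: (@v0 x _ _ y) => //; first exact: Lmeet.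
  by rewrite lexI xy leUl.
exact: leIl.
Qed.

Let v0_meet x y z : L x -> L y -> L z -> x <= y -> v x y = 0%N ->
  v (meet x z) (meet y z) = 0%N.
Proof.
move=> Lx Ly Lz xy h.
have Lyz := Lmeet Ly Lz.
have -> : meet x z = meet (meet y z) x.
  by rewrite (meetC y) -meetA (meet_idPr xy) meetC.
rewrite valL.2 //; apply: (@v0 x _ _ y) => //; first exact: Ljoin.
  exact: leUr.
by rewrite leUx xy leIl.
Qed.

(** Valuations are controlled on comparable pairs only, so an arbitrary pair is measured between its
    meet and its join. *)
Definition in_kernel x y := v (meet x y) (join x y) = 0%N.

(** The interval spanned by [x] and [z] lies between [meet (meet y z) x] and [join (join y z) x],
    and [meet x y] and [join x y] cut this larger interval into three parts of value 0. *)
Lemma in_kernel_trans x y z : L x -> L y -> L z ->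
  in_kernel x y -> in_kernel y z -> in_kernel x z.
Proof.
rewrite /in_kernel => Lx Ly Lz hxy hyz.
have Lxy := Lmeet Lx Ly; have Uxy := Ljoin Lx Ly.
have Lyz := Lmeet Ly Lz; have Uyz := Ljoin Ly Lz.
have m1 : v (meet y z) y = 0%N.
  by apply: v0 hyz => //; rewrite ?leIl ?leUl.
have m2 : v y (join y z) = 0%N.
  by apply: v0 hyz => //; rewrite ?leIl ?leUl.
have h1 := v0_meet Lyz Ly Lx (leIl _ _) m1.
have h2 := v0_join Ly Uyz Lx (leUl _ _) m2.
rewrite (meetC y x) in h1; rewrite (joinC y x) in h2.
have h3 : v (meet (meet y z) x) (join x y) = 0%N.
  apply: v0_trans h1 hxy => //; first exact: Lmeet.
    by lattice_le.
  by lattice_le.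
have h4 : v (meet (meet y z) x) (join (join y z) x) = 0%N.
  apply: v0_trans h3 h2 => //; [exact: Lmeet|exact: Ljoin| |].
    by lattice_le.
  by lattice_le.
apply: v0 h4; by [lattice_le|do ?[apply: Lmeet|apply: Ljoin]].
Qed.

Lemma in_kernel_sym x y : in_kernel x y -> in_kernel y x.
Proof. by rewrite /in_kernel meetC joinC. Qed.

Let ker_meet x y z : L x -> L y -> L z -> in_kernel x y ->
  in_kernel (meet x z) (meet y z).
Proof.
rewrite /in_kernel => Lx Ly Lz h.
have := v0_meet (Lmeet Lx Ly) (Ljoin Lx Ly) Lz (le_trans (leIl _ _) (leUl _ _)) h.
apply: v0; by [lattice_le|do ?[apply: Lmeet|apply: Ljoin]].
Qed.

Let ker_join x y z : L x -> L y -> L z -> in_kernel x y ->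
  in_kernel (join x z) (join y z).
Proof.
rewrite /in_kernel => Lx Ly Lz h.
have := v0_join (Lmeet Lx Ly) (Ljoin Lx Ly) Lz (le_trans (leIl _ _) (leUl _ _)) h.
apply: v0; by [lattice_le|do ?[apply: Lmeet|apply: Ljoin]].
Qed.

Lemma in_kernel_meet x x' y y' : L x -> L x' -> L y -> L y' ->
  in_kernel x x' -> in_kernel y y' -> in_kernel (meet x y) (meet x' y').
Proof.
move=> Lx Lx' Ly Ly' hx hy; apply: (@in_kernel_trans _ (meet x' y));
  try exact: Lmeet; first exact: ker_meet.
by rewrite ![meet x' _]meetC; exact: ker_meet.
Qed.

Lemma in_kernel_join x x' y y' : L x -> L x' -> L y -> L y' ->
  in_kernel x x' -> in_kernel y y' -> in_kernel (join x y) (join x' y').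
Proof.
move=> Lx Lx' Ly Ly' hx hy; apply: (@in_kernel_trans _ (join x' y));
  try exact: Ljoin; first exact: ker_join.
by rewrite ![join x' _]joinC; exact: ker_join.
Qed.

End Kernel.

(* Membership in a generated congruence is witnessed in a finitely generated
   sublattice, and there every valuation has a congruence as its kernel. *)
Lemma vanishing_on_generated X x y : smallest (@congruence _ K) [set` X] (x, y) ->
  exists F, forall L v, sublattice L -> [set` F] `<=` L -> valuation L v ->
    (forall p, p \in X -> in_kernel v p.1 p.2) -> in_kernel v x y.
Proof.
(* Membership in [F] is part of the induction hypothesis because [in_kernel] is known to be a
   congruence only among elements of [L]. *)
pose good F x y := [/\ x \in F, y \in F & forall L v, sublattice L ->
  [set` F] `<=` L -> valuation L v ->
  (forall p, p \in X -> in_kernel v p.1 p.2) -> in_kernel v x y].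
suff : smallest (@congruence _ K) [set` X] `<=` [set p | exists F, good F p.1 p.2].
  by move=> /[apply] -[F [_ _ h]]; exists F.
apply: smallest_sub => [|[a b] abX]; last first.
  exists [:: a; b]; split; rewrite ?inE ?eqxx ?orbT // => L v _ _ _ h.
  exact: (h (a, b)).
have binary (op : K -> K -> K) :
    (forall L v x x' y y', sublattice L -> valuation L v ->
      L x -> L x' -> L y -> L y' ->
      in_kernel v x x' -> in_kernel v y y' -> in_kernel v (op x y) (op x' y')) ->
    forall x x' y y', (exists F, good F x x') -> (exists F, good F y y') ->
      exists F, good F (op x y) (op x' y').
  move=> H a a' b b' [F [Fa Fa' hF]] [G [Gb Gb' hG]].
  exists (op a b :: op a' b' :: F ++ G).
  split; rewrite ?inE ?eqxx ?orbT // => L v sL FL vL hX.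
  have FL' : [set` F] `<=` L.
    by move=> z zF; apply: FL; rewrite /= !inE mem_cat zF !orbT.
  have GL' : [set` G] `<=` L.
    by move=> z zG; apply: FL; rewrite /= !inE mem_cat zG !orbT.
  apply: (H L v _ _ _ _ sL vL (FL' _ Fa) (FL' _ Fa') (GL' _ Gb) (GL' _ Gb')).
    exact: hF L v sL FL' vL hX.
  exact: hG L v sL GL' vL hX.
split=> /=.
- move=> a; exists [:: a]; split; rewrite ?inE // => L v sL FL vL _.
  rewrite /in_kernel meetxx joinxx; apply: (valuation_refl vL).
  by apply: FL; rewrite /= inE.
- move=> a b [F [Fa Fb hF]]; exists F; split=> // L v sL FL vL hX.
  by apply: in_kernel_sym; exact: hF L v sL FL vL hX.
- move=> a b c [F [Fa Fb hF]] [G [Gb Gc hG]].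
  exists (F ++ G); split; rewrite ?mem_cat ?Fa ?Gc ?orbT // => L v sL FL vL hX.
  have FL' : [set` F] `<=` L by move=> z zF; apply: FL; rewrite /= mem_cat zF.
  have GL' : [set` G] `<=` L by move=> z zG; apply: FL; rewrite /= mem_cat zG orbT.
  apply: (in_kernel_trans sL vL (FL' _ Fa) (FL' _ Fb) (GL' _ Gc)).
    exact: hF L v sL FL' vL hX.
  exact: hG L v sL GL' vL hX.
- apply: binary => L v a a' b b' sL vL; exact: in_kernel_meet.
- apply: binary => L v a a' b b' sL vL; exact: in_kernel_join.
Qed.

Lemma in_kernel_le v x y : x <= y -> in_kernel v x y <-> v x y = 0%N.
Proof. by move=> xy; rewrite /in_kernel (meet_idPl xy) (join_idPr xy). Qed.

Lemma vanishing_below X u x y : generates X u -> x <= y ->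
  principal x y <= u ->
  exists F, forall L v, sublattice L -> [set` F] `<=` L -> valuation L v ->
    (forall p, p \in X -> v p.1 p.2 = 0%N) -> v x y = 0%N.
Proof.
move=> [uX leX] xy /principal_leP; rewrite uX => /vanishing_on_generated[F hF].
exists F => L v sL FL vL hX; apply/(in_kernel_le _ xy); apply: (hF L v sL FL vL) => p pX.
by apply/in_kernel_le; [exact: leX|exact: hX].
Qed.

Lemma vanishing_below_all X u (Y : seq (K * K)) : generates X u ->
  (forall p, p \in Y -> p.1 <= p.2 /\ principal p.1 p.2 <= u) ->
  exists F, forall L v, sublattice L -> [set` F] `<=` L -> valuation L v ->
    (forall p, p \in X -> v p.1 p.2 = 0%N) ->
    forall p, p \in Y -> v p.1 p.2 = 0%N.
Proof.
move=> uX; elim: Y => [|q Y IH] hY; first by exists [::].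
have [p pY|F hF] := IH; first by apply: hY; rewrite inE pY orbT.
have [qle qu] := hY q (mem_head _ _).
have [G hG] := vanishing_below uX qle qu.
exists (F ++ G) => L v sL FL vL hX p; rewrite inE => /orP[/eqP->|].
  by apply: (hG L) => // z zG; apply: FL; rewrite /= mem_cat zG orbT.
by apply: (hF L) => // z zF; apply: FL; rewrite /= mem_cat zF.
Qed.

(* Impredicative form of "(x, y) is projective to (a, b) through transpositions in L". *)
Definition projective L a b x y :=
  forall P : K -> K -> Prop, transposition_invariant L P -> P a b -> P x y.

(** The multiplicity of [[a, b]] among composition factors: the 0-1 weight marks the prime intervals
    projective to it. *)
Definition factor_count L a b :=
  total_weight L (fun x y => nat_of_bool `[< projective L a b x y >]).

Lemma projective_transpose L a b : transposition_invariant L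
  (fun x y => nat_of_bool `[< projective L a b x y >]).
Proof.
move=> x y Lx Ly; congr (nat_of_bool `[< _ >]); apply/propext.
by split=> h P hP /(h P hP); rewrite hP.
Qed.

Lemma projective_eq T L a b x y (w : K -> K -> T) :
  transposition_invariant L w -> projective L a b x y -> w x y = w a b.
Proof.
move=> w_inv /(_ (fun x y => w x y = w a b)); apply=> // {}x {}y Lx Ly.
by rewrite w_inv.
Qed.

(** * Counting composition factors in sublattices of finite length *)

Section FactorCount.
Hypothesis modK : modular K.
Variable L : set K.
Hypotheses (subL : sublattice L) (finL : finite_length L).

Lemma valuation_factor_count a b : valuation L (factor_count L a b).
Proof.
by apply: valuation_total_weight => //; exact: projective_transpose.
Qed.

Lemma factor_count_self a b : covers L a b -> factor_count L a b a b = 1%N.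
Proof.
move=> cab; have h : maximal_chain L a [:: b].
  by apply/maximal_chain_cons; split.
have := total_weightE modK subL (@projective_transpose L a b) finL h.
rewrite /= /factor_count => ->; rewrite weight_cons /weight big_nil addn0.
by rewrite asboolT // => P.
Qed.

Lemma factor_count_gt0 a b x y : L x -> L y -> x <= y ->
  factor_count L a b x y != 0%N ->
  exists s t, [/\ covers L s t, x <= s, t <= y & projective L a b s t].
Proof.
move=> Lx Ly xy; have [c hc <-] := exists_maximal_chain finL Lx Ly xy.
rewrite /factor_count total_weightE //; last exact: projective_transpose.
move=> /eqP nz; apply: contrapT => h; apply: nz.
rewrite /weight big_seq big1 // => p pc; rewrite asboolF // => pr; apply: h.
have [h1 h2] := maximal_chain_steps hc pc.
by exists p.1, p.2; split=> //; exact: hc.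
Qed.

(** A nonzero count places inside [[x, y]] an interval projective to [[a, b]], and projective
    intervals generate the same congruence. *)
Lemma factor_count_principal a b x y : L x -> L y -> x <= y ->
  factor_count L a b x y != 0%N -> principal a b <= principal x y.
Proof.
move=> Lx Ly xy /(factor_count_gt0 Lx Ly xy)[s [t [[_ _ st _] xs ty pr]]].
rewrite -(projective_eq (@principal_transpose L) pr).
exact: principal_sub (ltW st) ty.
Qed.

(** The intervals [e i] need not lie on a common chain. Jordan-Hoelder moves their factors onto the
    chain [s]: those of [e i] are counted on steps accepted by the invariant test [C i], and a step
    of nonzero value is accepted for at most one [i]. *)
Lemma sum_valuation_le (I : eqType) (r : seq I) (e : I -> K * K)
    (C : I -> K -> K -> bool) v x s :
  valuation L v -> L x -> maximal_chain L x s -> uniq r ->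
  (forall i, transposition_invariant L (C i)) ->
  (forall i, i \in r -> [/\ L (e i).1, L (e i).2,
     x <= (e i).1, (e i).1 <= (e i).2 & (e i).2 <= last x s]) ->
  (forall i y z, i \in r -> covers L y z -> (e i).1 <= y -> z <= (e i).2 ->
     C i y z) ->
  (forall p i j, p \in steps x s -> v p.1 p.2 != 0%N -> i \in r -> j \in r ->
     C i p.1 p.2 -> C j p.1 p.2 -> i = j) ->
  (\sum_(i <- r) v (e i).1 (e i).2 <= v x (last x s))%N.
Proof.
move=> vL Lx hs ur Cinv he Ce Cs.
pose w i y z := (v y z * C i y z)%N.
have w_inv i : transposition_invariant L (w i).
  by move=> y z Ly Lz; rewrite /w Cinv // vL.2.
have Ll := maximal_chain_last Lx hs.
have hw i : i \in r -> (v (e i).1 (e i).2 <= weight (w i) x s)%N.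
  move=> ir; have [L1 L2 h1 h12 h2] := he i ir.
  rewrite -(total_weightE modK subL (w_inv i) finL hs).
  have vw := valuation_total_weight modK subL (w_inv i) finL.
  apply: leq_trans (valuation_mono vw Lx L1 L2 Ll h1 h12 h2).
  have [c hc lc] := exists_maximal_chain finL L1 L2 h12.
  rewrite -lc total_weightE // (valuation_chain vL) // /weight.
  rewrite big_seq [X in (_ <= X)%N]big_seq; apply: leq_sum => p pc.
  have [p1 p2] := maximal_chain_steps hc pc.
  by rewrite /w Ce ?muln1 //; [exact: hc|rewrite -lc].
apply: (@leq_trans (\sum_(i <- r) weight (w i) x s)%N).
  by rewrite big_seq [X in (_ <= X)%N]big_seq; exact: leq_sum.
rewrite exchange_big (valuation_chain vL) //= /weight.
rewrite big_seq [X in (_ <= X)%N]big_seq; apply: leq_sum => p ps.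
have [v0|vn0] := eqVneq (v p.1 p.2) 0%N.
  by rewrite big1 // => i _; rewrite /w v0.
(* With the sums exchanged, it remains that at most one [i] accepts the step [p]. *)
rewrite -big_distrr /= -[X in (_ <= X)%N]muln1 leq_mul2l.
apply/orP; right; rewrite -big_mkcond /= sum1_count -size_filter.
case E: (filter _ r) => [|i [|j l]] //.
have [Ci ir] : C i p.1 p.2 /\ i \in r.
  by apply/andP; rewrite -(mem_filter (fun i => C i p.1 p.2)) E mem_head.
have [Cj jr] : C j p.1 p.2 /\ j \in r.
  apply/andP; rewrite -(mem_filter (fun i => C i p.1 p.2)) E.
  by rewrite !inE eqxx orbT.
have := filter_uniq (fun i => C i p.1 p.2) ur.
by rewrite E /= inE (Cs p i j) // eqxx.
Qed.

End FactorCount.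

(** * Comparing dimensions through generators *)

Lemma finite_length_generated F : locally_finite_length K ->
  finite_length (smallest (@sublattice _ K) [set` F]).
Proof. by apply; exact: finite_seq. Qed.

(* A weak form of Dilworth's description of generated congruences: the factors
   below u occur, up to projectivity, among those of the generators of u. *)
Lemma factor_of_generators X u (Y : seq (K * K)) :
  modular K -> generates X u ->
  (forall e, e \in Y -> e.1 <= e.2 /\ principal e.1 e.2 <= u) ->
  exists F, forall L, sublattice L -> finite_length L -> [set` F] `<=` L ->
    forall e x y, e \in Y -> covers L x y -> e.1 <= x -> y <= e.2 ->
    exists e' s t, [/\ e' \in X, covers L s t, e'.1 <= s, t <= e'.2 &
      projective L x y s t].
Proof.
move=> modK uX hY; have [F hF] := vanishing_below_all uX hY.
exists (F ++ unzip1 (X ++ Y) ++ unzip2 (X ++ Y)) => L sL fL FL.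
have FL1 : [set` F] `<=` L by move=> z zF; apply: FL; rewrite /= mem_cat zF.
have XYL (e : K * K) : e \in X ++ Y -> L e.1 /\ L e.2.
  move=> eX; have e1 : e.1 \in unzip1 (X ++ Y) by exact: map_f eX.
  have e2 : e.2 \in unzip2 (X ++ Y) by exact: map_f eX.
  by split; apply: FL; rewrite /= 2!mem_cat ?e1 ?e2 !orbT.
move=> e x y eY cxy ex ye; have [Lx Ly ltxy _] := cxy.
(* The count of factors projective to [[x, y]] is nonzero on [e], so by [hF] it is nonzero on some
   generator, which contains such a factor. *)
have vc := valuation_factor_count modK sL fL x y.
have [|Le1 Le2] := XYL e; first by rewrite mem_cat eY orbT.
have nze : factor_count L x y e.1 e.2 != 0%N.
  have := valuation_mono vc Le1 Lx Ly Le2 ex (ltW ltxy) ye.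
  by rewrite factor_count_self // lt0n.
have [e' e'X nz] :
    exists2 e' : K * K, e' \in X & factor_count L x y e'.1 e'.2 != 0%N.
  apply: contrapT => h; move/eqP: nze; apply; apply: (hF L) eY => // p pX.
  by apply/eqP; apply: contraPT h => nz; rewrite not_notE; exists p.
have [|Le'1 Le'2] := XYL e'; first by rewrite mem_cat e'X.
have [s [t [cst es te pr]]] :=
  factor_count_gt0 modK sL fL Le'1 Le'2 (uX.2 _ e'X) nz.
by exists e', s, t.
Qed.

Lemma generates_join X X' u u' : generates X u -> generates X' u' ->
  generates (X ++ X') (join u u').
Proof.
move=> uX uX'; split; last first.
  by move=> p; rewrite mem_cat => /orP[/uX.2|/uX'.2].
apply/seteqP; split; last first.
  apply: smallest_sub; first exact: Conc_congruence.
  move=> [x y] xyX; apply/principal_leP.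
  have : (x, y) \in X ++ X' by exact: xyX.
  rewrite mem_cat => /orP[{}xyX|{}xyX].
    by apply: le_trans (leUl _ _); exact: (generates_le uX xyX).
  by apply: le_trans (leUr _ _); exact: (generates_le uX' xyX).
have -> : smallest (@congruence _ K) [set` X ++ X'] =
    val (MkConc (mem_set (ex_intro2 _ _ [set` X ++ X'] (finite_seq _) erefl))).
  by [].
apply/Conc_leP; rewrite leUx; apply/andP; split; apply/Conc_leP.
  rewrite uX.1; apply: smallest_sub; first exact: smallest_congruence.
  by move=> p pX; apply: sub_gen_smallest; rewrite /= mem_cat pX.
rewrite uX'.1; apply: smallest_sub; first exact: smallest_congruence.
by move=> p pX; apply: sub_gen_smallest; rewrite /= mem_cat pX orbT.
Qed.

(** Each factor of [[a, b]] is projective to a factor of a generator of [u] or of [u']. In the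
    second case its value is 0; in the first it is projective further to a factor inside [[p, q]],
    so its value is at most [v p q]. *)
Lemma uniform_bound (a b p q : K) (u u' : Conc K) :
  modular K -> locally_finite_length K -> a <= b -> p <= q ->
  principal a b <= join u u' -> u <= principal p q ->
  exists n F, forall L v, sublattice L -> [set` F] `<=` L -> valuation L v ->
    (forall x y, L x -> L y -> x <= y -> principal x y <= u' -> v x y = 0%N) ->
    (v a b <= n * v p q)%N.
Proof.
move=> modK lfK ab pq abu upq.
have [X uX] := exists_generators u; have [X' uX'] := exists_generators u'.
have gen := generates_join uX uX'; have gpq := generates_principal pq.
have [|F1 hF1] := @factor_of_generators _ _ [:: (a, b)] modK gen.
  by move=> e; rewrite inE => /eqP->.
have [|F2 hF2] := @factor_of_generators _ _ X modK gpq.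
  move=> e eX; split; first exact: uX.2.
  exact: le_trans (generates_le uX eX) upq.
pose F := [:: a; b; p; q] ++ F1 ++ F2.
pose M := smallest (@sublattice _ K) [set` F].
have sM : sublattice M by exact: smallest_sublattice.
have fM : finite_length M := finite_length_generated _ lfK.
have FM z : z \in F -> M z by move=> zF; exact: sub_gen_smallest.
have [Ma Mb Mp Mq] : [/\ M a, M b, M p & M q].
  by split; apply: FM; rewrite !inE eqxx ?orbT.
have F1M : [set` F1] `<=` M.
  by move=> z /= zF; apply: FM; rewrite !mem_cat zF !orbT.
have F2M : [set` F2] `<=` M.
  by move=> z /= zF; apply: FM; rewrite !mem_cat zF !orbT.
have [s hs ls] := exists_maximal_chain fM Ma Mb ab.
(* The multiple is the length of a chain in [M], which is fixed before [L] and [v]; hence the bound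
   is uniform in both. *)
exists (size (steps a s)), F => L v sL FL vL vu'.
have ML : M `<=` L by apply: smallest_sub.
have vM := valuation_sub ML vL.
rewrite -ls (valuation_chain vM) // /weight big_seq.
rewrite -sum1_size big_distrl /= [X in (_ <= X)%N]big_seq.
apply: leq_sum => -[x y] xys /=; rewrite mul1n.
have [ax yb] := maximal_chain_steps hs xys; rewrite ls /= in ax yb.
have [e [s1 [t1 [eXX' c1 es1 te1 pr1]]]] :=
  hF1 M sM fM F1M (a, b) x y (mem_head _ _) (hs _ xys) ax yb.
rewrite -(projective_eq vM.2 pr1); have [Ms1 Mt1 /ltW st1 _] := c1.
move: eXX'; rewrite mem_cat => /orP[eX|eX']; last first.
  rewrite (vu' s1 t1) //; [exact: ML|exact: ML|].
  exact: le_trans (principal_sub es1 st1 te1) (generates_le uX' eX').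
have [e' [s2 [t2 [+ c2 es2 te2 pr2]]]] := hF2 M sM fM F2M e s1 t1 eX c1 es1 te1.
rewrite inE => /eqP e'E; subst e'; rewrite -(projective_eq vM.2 pr2).
have [Ms2 Mt2 /ltW st2 _] := c2.
exact: (valuation_mono vM Mp Ms2 Mt2 Mq es2 st2 te2).
Qed.

End CongruencesAndValuations.

(** * Cofinality and pigeonhole arguments in omega1 *)

Section Omega1.
Local Open Scope order_scope.
Local Open Scope classical_set_scope.
Context {d : Order.disp_t} (W : bOrderType d).
Hypothesis omega1P : is_omega1 W.

(** Without a bound, the closed initial segments up to the [g n], each split into an open segment
    and a point, would cover [W] by countably many countable sets. *)
Lemma omega1_sequence_bound (g : nat -> W) : exists b, forall n, g n < b.
Proof.
have [_ Wunc Wseg] := omega1P; apply: contrapT => nb; apply: Wunc.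
pose G (k : nat * bool) := if k.2 then [set b | b < g k.1] else [set g k.1].
have -> : [set: W] = \bigcup_k G k.
  apply/seteqP; split=> // b _; apply: contrapT => hb; apply: nb; exists b => n.
  rewrite ltNge le_eqVlt; apply/negP => /orP[/eqP bg|bg]; apply: hb.
    by exists (n, false).
  by exists (n, true).
apply: bigcup_countable => [|[n []] _]; first exact: countableP.
  exact: Wseg.
exact: countable1.
Qed.

Lemma omega1_seq_bound (s : seq W) : exists b, forall x, x \in s -> x < b.
Proof.
have [b hb] := omega1_sequence_bound (nth \bot s).
by exists b => x xs; rewrite -(nth_index \bot xs).
Qed.

Lemma uncountable_pigeonhole (T : countType) (k : W -> T) :
  exists c, infinite_set [set x | k x = c].
Proof.
have [_ Wunc _] := omega1P; apply: contrapT => h; apply: Wunc.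
have -> : [set: W] = \bigcup_c [set x | k x = c].
  by apply/seteqP; split=> // x _; exists (k x).
apply: bigcup_countable => [|c _]; first exact: countableP.
by apply: finite_set_countable; apply: contrapT => hc; apply: h; exists c.
Qed.

(** * Reading compact congruences as elements of S_omega1 *)

Section Isomorphism.
Local Notation meet := Order.meet.
Local Notation join := Order.join.
Context {d' : Order.disp_t} (K : latticeType d').
Hypotheses (modK : modular K) (lfK : locally_finite_length K).
Variable f : Conc K -> Somega1 W.
Hypotheses (f_bij : bijective f) (f0 : f \bot = \bot).
Hypothesis fU : forall x y, f (join x y) = join (f x) (f y).
Implicit Types (t u : Conc K) (v : K -> K -> nat) (F : seq K).

Definition first t : set W := (val (f t)).1.
Definition second t : set W := (val (f t)).2.

Lemma iso_leP t u :
  reflect (first t `<=` first u /\ second t `<=` second u) (t <= u).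
Proof.
suff -> : (t <= u) = (f t <= f u) by exact: Somega1_leP.
by rewrite !leEjoin -fU (inj_eq (bij_inj f_bij)).
Qed.

Lemma first_bot : first \bot = set0. Proof. by rewrite /first f0. Qed.

Lemma second_bot : second \bot = set0. Proof. by rewrite /second f0. Qed.

Lemma firstU t u : first (join t u) = first t `|` first u.
Proof. by rewrite /first fU. Qed.

Lemma secondU t u : second (join t u) = second t `|` second u.
Proof. by rewrite /second fU. Qed.

Lemma iso_eq0 t : first t = set0 -> second t = set0 -> t = \bot.
Proof.
by move=> h1 h2; apply/eqP; rewrite -lex0; apply/iso_leP; rewrite h1 h2; split; exact: sub0set.
Qed.

Lemma second_bounded t : first t = set0 -> exists a, second t `<=` ordinal_set a.
Proof.
rewrite /first /second => h.
by have /set_mem[[_ [_ ?]]|[[_ /(_ h)]]] := valP (f t).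
Qed.

Lemma second_cobounded t : first t !=set0 ->
  exists a, ~` ordinal_set a `<=` second t.
Proof.
rewrite /first /second => -[x h].
have /set_mem[[/= h0]|[_ [_ ?]]] := valP (f t) => //.
by move: h; rewrite h0.
Qed.

Lemma iso_exists (A B : set W) : Somega1_set (A, B) ->
  exists t, first t = A /\ second t = B.
Proof.
move=> hAB; have [g _ fK] := f_bij.
by exists (g (MkSomega1 (mem_set hAB))); rewrite /first /second fK.
Qed.

Definition clopen (a b : W) : set W := [set x | a <= x /\ x < b].

Lemma interval_clopen a b : interval_algebra (clopen a b).
Proof.
apply: sub_gen_smallest; exists `[a, b[%O => //.
apply/seteqP; split=> x /=; rewrite in_itv /=; first by move/andP.
by move=> [-> ->].
Qed.

Lemma iso_clopen a b : exists t, first t = set0 /\ second t = clopen a b.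
Proof.
apply: iso_exists; left; split=> //; split; first exact: interval_clopen.
by exists b => x [].
Qed.

Lemma omega1_nonempty : [set: W] <> set0.
Proof.
by move=> h; have : [set: W] \bot by []; rewrite h.
Qed.

(** Together with [iso_clopen] this splits the top element for use in [uniform_bound]; the full
    first component absorbs every other one. *)
Lemma iso_coclopen a b :
  exists t, first t = setT /\ second t = ~` clopen a b.
Proof.
have [_ _ _ _ BC] := interval_algebra_boolean W.
apply: iso_exists; right; split; first by split; [right|exact: omega1_nonempty].
split; first by apply: BC; exact: interval_clopen.
by exists b => x /= xb [_].
Qed.

Lemma iso_singleton x : exists t, first t = [set x] /\ second t = setT.
Proof.
have [_ BT _ _ _] := interval_algebra_boolean W.
apply: iso_exists; right; split.
  by split; [left; exact: finite_set1|move=> /= h; have : [set x] x by []; rewrite h].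
by split; [exact: BT|exists \bot].
Qed.

Lemma iso_top : exists t, first t = setT /\ second t = setT.
Proof.
have [_ BT _ _ _] := interval_algebra_boolean W.
apply: iso_exists; right; split; first by split; [right|exact: omega1_nonempty].
by split; [exact: BT|exists \bot].
Qed.

Lemma seq_second_bounded (s : seq (Conc K)) :
  exists a, forall t, t \in s -> first t = set0 -> second t `<=` ordinal_set a.
Proof.
elim: s => [|t s [a ha]]; first by exists \bot.
have [h|h] := pselect (first t = set0); last first.
  by exists a => u; rewrite inE => /orP[/eqP->|/ha].
have [b hb] := second_bounded h.
exists (Order.max a b) => u; rewrite inE => /orP[/eqP-> _|us hu] x.
  by move=> /hb; rewrite /ordinal_set /= lt_max => ->; rewrite orbT.
by move=> /(ha _ us hu); rewrite /ordinal_set /= lt_max => ->.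
Qed.

(* Containing x in the first component is a prime property: a finite join has it
   only if one of its terms does. *)
Lemma interval_with_first u X x :
  generates X u -> first u = setT -> second u = setT ->
  exists e : (K * K) * (K * K), [/\ e.1 \in X, e.1.1 <= e.2.1, e.2.1 <= e.2.2,
    e.2.2 <= e.1.2 & first (principal e.2.1 e.2.2) = [set x]].
Proof.
move=> uX u1 u2.
pose Q t := ~ first t x.
have Q0 : Q \bot by rewrite /Q first_bot.
have QU a b : Q a -> Q b -> Q (join a b) by rewrite /Q firstU => qa qb [].
have Qle a b : a <= b -> Q b -> Q a by move=> /iso_leP[ab _] qb /ab.
have [w [w1 w2]] := iso_singleton x.
have [Z wZ] := exists_generators w.
have [e eZ ex] : exists2 e : K * K, e \in Z & first (principal e.1 e.2) x.
  apply: contrapT => h; have : Q w.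
    by apply: (generates_ind wZ) => // p pZ px; apply: h; exists p.
  by rewrite /Q w1; apply.
have e12 := wZ.2 _ eZ.
have [|F hF] := @factor_of_generators _ _ _ _ [:: e] modK uX.
  move=> e'; rewrite inE => /eqP->; split=> //.
  by apply/iso_leP; rewrite u1 u2; split.
pose M := smallest (@sublattice _ K) [set` [:: e.1, e.2 & F]].
have sM : sublattice M by exact: smallest_sublattice.
have fM : finite_length M := finite_length_generated _ lfK.
have FM z : z \in [:: e.1, e.2 & F] -> M z by move=> zF; exact: sub_gen_smallest.
have [Me1 Me2] : M e.1 /\ M e.2 by split; apply: FM; rewrite !inE eqxx ?orbT.
have FM' : [set` F] `<=` M by move=> z /= zF; apply: FM; rewrite !inE zF !orbT.
have [c hc lc] := exists_maximal_chain fM Me1 Me2 e12.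
(* The whole interval [e] need not be projective into a generator of [u], but its prime factors are,
   and one of them still carries [x]. *)
have [p pc px] : exists2 p, p \in steps e.1 c & first (principal p.1 p.2) x.
  apply: contrapT => h; have : Q (principal e.1 (last e.1 c)).
    by apply: (chain_ind hc) => // p pZ px; apply: h; exists p.
  by rewrite /Q lc; apply.
have [ep pe] := maximal_chain_steps hc pc; rewrite lc in pe.
have [e' [s [t [e'X [_ _ /ltW st _] es te pr]]]] :=
  hF M sM fM FM' e p.1 p.2 (mem_head _ _) (hc _ pc) ep pe.
exists (e', (s, t)); split=> //=.
rewrite (projective_eq (@principal_transpose _ _ M) pr).
have [_ _ /ltW p12 _] := hc _ pc.
apply/seteqP; split=> [y|_ ->] //.
have /iso_leP[+ _] := le_trans (principal_sub ep p12 pe) (generates_le wZ eZ).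
by rewrite w1; apply.
Qed.

(* Over [alpha, beta), the dimension of [a, b] is at most n times that of [p, q]. *)
Definition bounded_multiple (a b p q : K) (alpha beta : W) n :=
  exists F, forall L v, sublattice L -> [set` F] `<=` L -> valuation L v ->
    (forall x y, L x -> L y -> x <= y ->
       second (principal x y) `&` clopen alpha beta = set0 -> v x y = 0%N) ->
    (v a b <= n * v p q)%N.

Lemma bounded_multiple_le a b p q alpha beta beta' n : beta <= beta' ->
  bounded_multiple a b p q alpha beta' n -> bounded_multiple a b p q alpha beta n.
Proof.
move=> bb [F hF]; exists F => L v sL FL vL h; apply: (hF L) => // x y Lx Ly xy h'.
apply: h => //; apply/seteqP; split=> // z [z1 [z2 z3]].
by rewrite -h'; split=> //; split=> //; exact: lt_le_trans bb.
Qed.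

Lemma exists_bounded_multiple a b p q alpha : a <= b -> p <= q ->
  ~` ordinal_set alpha `<=` second (principal p q) ->
  exists n, forall beta, bounded_multiple a b p q alpha beta n.
Proof.
move=> ab pq hpq.
have ex beta : exists n, bounded_multiple a b p q alpha beta n.
  have [u [u1 u2]] := iso_clopen alpha beta.
  have [u' [u'1 u'2]] := iso_coclopen alpha beta.
  have abu : principal a b <= join u u'.
    apply/iso_leP; rewrite firstU secondU u1 u2 u'1 u'2 setUT.
    by rewrite setUv; split.
  have upq : u <= principal p q.
    apply/iso_leP; rewrite u1 u2; split=> // x [ax _]; apply: hpq.
    by apply/negP; rewrite -leNgt.
  have [n [F hF]] := uniform_bound modK lfK ab pq abu upq.
  exists n, F => L v sL FL vL h; apply: (hF L) => // x y Lx Ly xy xyu'.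
  apply: h => //; apply/seteqP; split=> // z [z1 z2].
  by have /iso_leP[_ /(_ z z1)] := xyu'; rewrite u'2.
apply: contrapT => h.
(* If no [n] serves all [beta], the ordinals [g n] at which [n] fails have a common bound, and the
   [n] found for that bound would serve [g n] as well. *)
have /choice[g hg] : forall n, exists beta,
    ~ bounded_multiple a b p q alpha beta n.
  move=> n; apply: contrapT => hn; apply: h; exists n => beta.
  by apply: contrapT => hb; apply: hn; exists beta.
have [beta hbeta] := omega1_sequence_bound g.
have [n hn] := ex beta.
exact: (hg n (bounded_multiple_le (ltW (hbeta n)) hn)).
Qed.

(** * The counting contradiction *)

Lemma isomorphism_absurd : False.
Proof.
have [top [top1 top2]] := iso_top.
have [X0 topX0] := exists_generators top.
(* [D] is nested as generator of the top, interval inside it, then ordinal [alpha] and uniform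
   multiple [n]. *)
pose spec (x : W) (D : ((K * K) * (K * K)) * (W * nat)) :=
  [/\ D.1.1 \in X0, [/\ D.1.1.1 <= D.1.2.1, D.1.2.1 <= D.1.2.2 &
    D.1.2.2 <= D.1.1.2], first (principal D.1.2.1 D.1.2.2) = [set x],
    ~` ordinal_set D.2.1 `<=` second (principal D.1.2.1 D.1.2.2) &
    forall beta, bounded_multiple D.1.1.1 D.1.1.2 D.1.2.1 D.1.2.2 D.2.1 beta D.2.2].
have /choice[D hD] : forall x, exists D, spec x D.
  move=> x; have [e [eX h1 h2 h3 e1]] := interval_with_first x topX0 top1 top2.
  have [|alpha halpha] := @second_cobounded (principal e.2.1 e.2.2).
    by exists x; rewrite e1.
  have [n hn] := exists_bounded_multiple (topX0.2 _ eX) h2 halpha.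
  by exists (e, (alpha, n)).
(* The colour of [x] is the position of its generator in [X0] together with its multiple. *)
have [[k n] /(infinite_set_fset n.+1)[B Bk Bn]] :=
  uncountable_pigeonhole (fun x => (index (D x).1.1 X0, (D x).2.2)).
pose r : seq W := finmap.enum_fset B.
have ur : uniq r by exact: finmap.fset_uniq.
have {}Bk x : x \in r -> index (D x).1.1 X0 = k /\ (D x).2.2 = n.
  by move=> xr; have [] := Bk x xr.
have [x0 x0r] : exists x, x \in r.
  by exists (nth \bot r 0); apply: mem_nth; exact: leq_trans Bn.
pose a := (D x0).1.1.1; pose b := (D x0).1.1.2.
have Dab x : x \in r -> (D x).1.1 = (a, b).
  move=> xr; rewrite /a /b -surjective_pairing.
  have [DX _ _ _ _] := hD x; have [DX' _ _ _ _] := hD x0.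
  by rewrite -(nth_index (a, b) DX) (Bk _ xr).1 -(Bk _ x0r).1 nth_index.
pose p x := (D x).1.2.1; pose q x := (D x).1.2.2; pose alpha x := (D x).2.1.
have hr x : x \in r -> [/\ [/\ a <= p x, p x <= q x & q x <= b],
    first (principal (p x) (q x)) = [set x],
    ~` ordinal_set (alpha x) `<=` second (principal (p x) (q x)) &
    forall beta, bounded_multiple a b (p x) (q x) (alpha x) beta n].
  move=> xr; have [_] := hD x; rewrite (Bk x xr).2 (Dab x xr); exact.
have ab : a <= b by have [[h1 h2 h3] _ _ _] := hr _ x0r; exact: le_trans h1 (le_trans h2 h3).
pose G := [:: a, b & map p r ++ map q r].
pose M := smallest (@sublattice _ K) [set` G].
have sM : sublattice M by exact: smallest_sublattice.
have fM : finite_length M := finite_length_generated _ lfK.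
have GM z : z \in G -> M z by move=> zG; exact: sub_gen_smallest.
have [Ma Mb] : M a /\ M b by split; apply: GM; rewrite !inE eqxx ?orbT.
have Mpq x : x \in r -> M (p x) /\ M (q x).
  by move=> xr; split; apply: GM; rewrite !inE mem_cat !map_f ?orbT.
have [s hs ls] := exists_maximal_chain fM Ma Mb ab.
(* [alpha0] bounds the second component of every step of [s] with empty first component; steps below
   two different [principal (p x) (q x)] are of this kind. *)
have [alpha0 halpha0] :=
  seq_second_bounded [seq principal e.1 e.2 | e <- steps a s].
have [alpha1 halpha1] := omega1_seq_bound (alpha0 :: map alpha r).
have [beta hbeta] := omega1_seq_bound [:: alpha1].
(* [u] lives beyond [alpha0] and all [alpha x], and it is nonzero because its second component
   contains [alpha1]. *)
have [u [u1 u2]] := iso_clopen alpha1 beta.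
have [X uX] := exists_generators u.
have /choice[Fr hFr] : forall x, exists F, x \in r -> forall L v,
    sublattice L -> [set` F] `<=` L -> valuation L v ->
    (forall y z, L y -> L z -> y <= z ->
       second (principal y z) `&` clopen (alpha x) beta = set0 -> v y z = 0%N) ->
    (v a b <= n * v (p x) (q x))%N.
  move=> x; have [xr|xr] := boolP (x \in r); last by exists [::].
  by have [_ _ _ /(_ beta)[F hF]] := hr x xr; exists F => _.
have uab : u <= principal a b.
  have [[h1 h2 h3] _ h _] := hr _ x0r.
  apply: le_trans (principal_sub h1 h2 h3); apply/iso_leP; rewrite u1 u2.
  split=> // y [ay _]; apply: h; apply/negP; rewrite -leNgt.
  by apply: le_trans ay; apply: ltW; apply: halpha1; rewrite inE map_f ?orbT.
have [|F0 hF0] := @factor_of_generators _ _ _ _ X modK (generates_principal ab).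
  move=> e eX; split; first exact: uX.2.
  exact: le_trans (generates_le uX eX) uab.
have [e eX ne] : exists2 e : K * K, e \in X & e.1 != e.2.
  apply: contrapT => h; have u0 : u = \bot.
    apply: (@generates_ind _ _ (fun t => t = \bot) _ _ uX) => //.
    - by move=> t t' -> ->; rewrite joinxx.
    - by move=> t t' tt' t0; apply/eqP; rewrite -lex0 -t0.
    - move=> e eX; have [->|ne] := eqVneq e.1 e.2; first exact: principal_refl.
      by case: h; exists e.
  have : second u alpha1.
    by rewrite u2; split=> //; apply: hbeta; rewrite inE.
  by rewrite u0 second_bot.
(* [L] holds the witnesses needed for the valuation [v], while [s] is maximal only in the smaller
   [M]; [v] is restricted to [M] to be summed along [s]. *)
pose H := G ++ [:: e.1, e.2 & F0] ++ flatten (map Fr r).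
pose L := smallest (@sublattice _ K) [set` H].
have sL : sublattice L by exact: smallest_sublattice.
have fL : finite_length L := finite_length_generated _ lfK.
have HL z : z \in H -> L z by move=> zH; exact: sub_gen_smallest.
have ML : M `<=` L.
  by apply: smallest_sub => // z zG; apply: HL; rewrite mem_cat zG.
have F0L : [set` F0] `<=` L.
  by move=> z /= zF; apply: HL; rewrite !(mem_cat, inE) zF !orbT.
have FrL x : x \in r -> [set` Fr x] `<=` L.
  move=> xr z /= zF; apply: HL; rewrite !mem_cat; apply/orP; right; apply/orP; right.
  by apply/flattenP; exists (Fr x) => //; exact: map_f.
have [Le1 Le2] : L e.1 /\ L e.2.
  by split; apply: HL; rewrite !(mem_cat, inE) eqxx ?orbT.
have [[|c2 c] hc lc] := exists_maximal_chain fL Le1 Le2 (uX.2 _ eX).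
  by rewrite -lc /= eqxx in ne.
have /maximal_chain_cons[ce hc'] := hc.
have c2e : c2 <= e.2 by rewrite -lc; exact: maximal_chain_le hc'.
have [_ Lc2 lt_ec _] := ce.
pose v := factor_count L e.1 c2.
have vL : valuation L v by exact: valuation_factor_count.
have vM := valuation_sub ML vL.
have [e' [s1 [t1 [+ c1 es1 te1 pr1]]]] :=
  hF0 L sL fL F0L e e.1 c2 eX ce (lexx _) c2e.
rewrite inE => /eqP e'E; subst e'.
have vab : (0 < v a b)%N.
  have [Ls1 Lt1 /ltW st1 _] := c1.
  apply: leq_trans (valuation_mono vL (ML _ Ma) Ls1 Lt1 (ML _ Mb) es1 st1 te1).
  by rewrite (projective_eq vL.2 pr1) /v factor_count_self.
pose th := principal e.1 c2.
have thu : th <= u.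
  exact: le_trans (principal_sub (lexx _) (ltW lt_ec) c2e) (generates_le uX eX).
(* The point [y0] will lie in the second component of every interval of [L] on which [v] is
   nonzero. *)
have [y0 y0th] : second th !=set0.
  apply/set0P/eqP => th2; have /principal_eq0 : th = \bot.
    apply: iso_eq0 => //; apply/seteqP; split=> // z.
    by have /iso_leP[+ _] := thu; rewrite u1; apply.
  by move=> ec; rewrite ec ltxx in lt_ec.
have [ay0 y0b] : clopen alpha1 beta y0.
  by have /iso_leP[_ /(_ y0 y0th)] := thu; rewrite u2.
have vth x y : L x -> L y -> x <= y -> v x y != 0%N -> second (principal x y) y0.
  move=> Lx Ly xy nz.
  by have /iso_leP[_] := factor_count_principal modK sL fL Lx Ly xy nz; apply.
have sum_le : (\sum_(x <- r) v (p x) (q x) <= v a b)%N.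
  rewrite -ls.
  apply: (@sum_valuation_le _ _ modK _ sM fM _ r (fun x => (p x, q x))
    (fun x y z => principal y z <= principal (p x) (q x))) => //.
  - by move=> x y z My Mz; rewrite (principal_transpose My Mz).
  - by move=> x xr; have [? ?] := Mpq x xr; have [[? ? ?] _ _ _] := hr x xr; rewrite ls.
  - move=> x y z xr [_ _ /ltW yz _] py zq; exact: principal_sub py yz zq.
  (* A step accepted for two different points has empty first component, so its second component
     lies below [alpha0] and misses [y0], which forces the value 0. *)
  - move=> g x y gs nz xr yr /iso_leP[g1 _] /iso_leP[g2 _].
    have [Mg1 Mg2 /ltW g12 _] := hs _ gs.
    have [_ f1 _ _] := hr x xr; have [_ f2 _ _] := hr y yr.
    apply: contrapT => xy.
    have g0 : first (principal g.1 g.2) = set0.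
      apply/seteqP; split=> // z hz; apply: xy.
      by have := g1 z hz; have := g2 z hz; rewrite f1 f2 => <- <-.
    have := halpha0 _ (map_f (fun e => principal e.1 e.2) gs) g0 y0
      (vth _ _ (ML _ Mg1) (ML _ Mg2) g12 nz).
    rewrite /ordinal_set /= => h.
    by have := lt_trans h (halpha1 alpha0 (mem_head _ _)); rewrite ltNge ay0.
have le_mul x : x \in r -> (v a b <= n * v (p x) (q x))%N.
  move=> xr; apply: (hFr x xr L) => //; first exact: FrL.
  (* [y0] lies in [[alpha x, beta)], so [v] vanishes on every interval whose second component misses
     that set. *)
  move=> y z Ly Lz yz h; apply/eqP; apply: contraT => nz.
  have : (second (principal y z) `&` clopen (alpha x) beta) y0.
    split; first exact: vth.
    split=> //; apply: le_trans ay0; apply: ltW; apply: halpha1.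
    by rewrite inE map_f ?orbT.
  by rewrite h.
have : (n.+1 * v a b <= n * v a b)%N.
  apply: (@leq_trans (size r * v a b)%N); first by rewrite leq_mul2r Bn orbT.
  apply: (@leq_trans (n * \sum_(x <- r) v (p x) (q x))%N); last first.
    by rewrite leq_mul2l sum_le orbT.
  rewrite -sum1_size big_distrl big_distrr /= big_seq [X in (_ <= X)%N]big_seq.
  by apply: leq_sum => x xr; rewrite mul1n; exact: le_mul.
by rewrite mulSn; lia.
Qed.

End Isomorphism.
End Omega1.

Theorem corollary6p3 (d : Order.disp_t) (omega1 : bOrderType d)
    (omega1P : is_omega1 omega1) :
  ~ exists (d' : Order.disp_t) (K : latticeType d'),
      [/\ modular K,
          locally_finite_length K &
          semilattice_isomorphic (Conc K) (Somega1 omega1)].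
Proof.
move=> [d' [K [modK lfK [f [f_bij f0 fU]]]]].
exact (isomorphism_absurd omega1P modK lfK f_bij f0 fU).
Qed.
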